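(* Let $\omega$ be a complete congruence relation on a semigroup $S$, and let $P^{\Box}$ be a cubic Pythagorean fuzzy bi-ideal of $S$. Then the lower approximation $\underline{App}(P^{\Box})$ is a cubic Pythagorean fuzzy bi-ideal of $S$.
   Context: Congruence: an equivalence relation $\omega$ on $S$ is a congruence relation if $(z_1,z_2)\in\omega$ implies $(z_1x,z_2x)\in\omega$ and $(xz_1,xz_2)\in\omega$ for all $x\in S$. $[z]_\omega$ denotes the class of $z$; $\omega$ is complete if $[z_1]_\omega[z_2]_\omega=[z_1z_2]_\omega$ for all $z_1,z_2\in S$. Intervals: closed subintervals $[a^-,a^+]$ of $[0,1]$ are ordered componentwise; $\min$, infima $\bigwedge$ and suprema $\bigvee$ are taken componentwise. A cubic Pythagorean fuzzy set (CPFS) on $S$ is $P^{\Box}=\{\langle z,[\zeta_{\widetilde p}(z),\eta_{\widetilde p}(z)],(\zeta_p(z),\eta_p(z))\rangle : z\in S\}$, where $\zeta_{\widetilde p}(z)=[\zeta_p^-(z),\zeta_p^+(z)]$ and $\eta_{\widetilde p}(z)=[\eta_p^-(z),\eta_p^+(z)]$ are closed subintervals of $[0,1]$ with $(\zeta_p^+(z))^2+(\eta_p^+(z))^2\le 1$, and $\zeta_p(z),\eta_p(z)\in[0,1]$ with $\zeta_p(z)^2+\eta_p(z)^2\le 1$. Here $\zeta_p,\eta_p$ are independent data. A CPFS is a cubic Pythagorean fuzzy bi-ideal of $S$ if for all $x,y,z\in S$: $\zeta_{\widetilde p}(xyz)\ge\min\{\zeta_{\widetilde p}(x),\zeta_{\widetilde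 p}(z)\}$, $\eta_{\widetilde p}(xyz)\ge\min\{\eta_{\widetilde p}(x),\eta_{\widetilde p}(z)\}$, $\zeta_p(xyz)\le\max\{\zeta_p(x),\zeta_p(z)\}$, $\eta_p(xyz)\le\max\{\eta_p(x),\eta_p(z)\}$. Lower approximation $\underline{App}(P^{\Box})$: it has components $\underline{\zeta_{\widetilde p}}(z)=\bigwedge_{z'\in[z]_\omega}\zeta_{\widetilde p}(z')$, $\underline{\eta_{\widetilde p}}(z)=\bigvee_{z'\in[z]_\omega}\eta_{\widetilde p}(z')$, $\underline{\zeta_p}(z)=\bigwedge_{z'\in[z]_\omega}\zeta_p(z')$, $\underline{\eta_p}(z)=\bigvee_{z'\in[z]_\omega}\eta_p(z')$. *)

(* Defs.v *)
From mathcomp Require Import all_boot all_order all_algebra.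
From mathcomp Require Import all_classical all_reals.

Set Implicit Arguments.
Unset Strict Implicit.
Unset Printing Implicit Defensive.

Import Order.TTheory GRing.Theory Num.Theory.

Local Open Scope classical_set_scope.
Local Open Scope ring_scope.

Section Congruence.
Variables (S : semigroupType) (omega : S -> S -> Prop).

Definition congruence : Prop :=
  RelationClasses.Equivalence omega /\
  forall z1 z2, omega z1 z2 ->
    forall x, omega (z1 * x)%g (z2 * x)%g /\ omega (x * z1)%g (x * z2)%g.

Definition cls (z : S) : set S := [set z' | omega z z'].

Definition complete_congruence : Prop :=
  congruence /\
  forall z1 z2, [set (a * b)%g | a in cls z1 & b in cls z2] = cls (z1 * z2)%g.

End Congruence.

Section Intervals.
Variable R : realType.

(* The pair (a^-, a^+) stands for [a^-, a^+]; that it is a genuine closed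
   subinterval of [0, 1] is the predicate [subitv01]. *)
Definition itvpair : Type := (R * R)%type.
Implicit Types (a b : itvpair) (A : set itvpair).

Definition subitv01 a : Prop := [/\ 0 <= a.1, a.1 <= a.2 & a.2 <= 1].

Definition le_itv a b : Prop := a.1 <= b.1 /\ a.2 <= b.2.

Definition min_itv a b : itvpair := (Num.min a.1 b.1, Num.min a.2 b.2).

Definition inf_itv A : itvpair :=
  (inf [set a.1 | a in A], inf [set a.2 | a in A]).

Definition sup_itv A : itvpair :=
  (sup [set a.1 | a in A], sup [set a.2 | a in A]).

End Intervals.

Section CubicPythagoreanFuzzySets.
Variables (R : realType) (S : semigroupType).

(* Only the raw components: the constraints making them a cubic Pythagorean
   fuzzy set are in [is_cpfs], so that they have to be proved for a derived
   family such as the lower approximation. *)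
Record cubic_data : Type := CubicData {
  zeta_itv : S -> itvpair R;
  eta_itv  : S -> itvpair R;
  zeta     : S -> R;
  eta      : S -> R
}.

Implicit Types P : cubic_data.

Definition is_cpfs P : Prop :=
  forall z,
    [/\ subitv01 (zeta_itv P z),
        subitv01 (eta_itv P z) &
        (zeta_itv P z).2 ^+ 2 + (eta_itv P z).2 ^+ 2 <= 1] /\
    [/\ 0 <= zeta P z <= 1,
        0 <= eta P z <= 1 &
        zeta P z ^+ 2 + eta P z ^+ 2 <= 1].

(* All the interval-valued inequalities are lower bounds and all the
   real-valued ones are upper bounds, for zeta and eta alike. *)
Definition cpf_biideal P : Prop :=
  is_cpfs P /\
  forall x y z : S,
    [/\ le_itv (min_itv (zeta_itv P x) (zeta_itv P z))
               (zeta_itv P (x * y * z)%g),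
        le_itv (min_itv (eta_itv P x) (eta_itv P z))
               (eta_itv P (x * y * z)%g),
        zeta P (x * y * z)%g <= Num.max (zeta P x) (zeta P z) &
        eta P (x * y * z)%g <= Num.max (eta P x) (eta P z)].

Definition lower_App (omega : S -> S -> Prop) P : cubic_data :=
  {| zeta_itv z := inf_itv [set zeta_itv P z' | z' in cls omega z];
     eta_itv z  := sup_itv [set eta_itv P z' | z' in cls omega z];
     zeta z     := inf [set zeta P z' | z' in cls omega z];
     eta z      := sup [set eta P z' | z' in cls omega z] |}.

End CubicPythagoreanFuzzySets.

(* Main.v *)
(** Completeness gives [[x y z] = [x][y][z]], so the values of a membership
    function on the class of [x y z] are controlled, through the bi-ideal
    inequalities, by its values on the classes of [x] and [z]; the infima and
    suprema then inherit these inequalities.  For the components [sup min] and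
    [inf max], near-optimal elements are chosen separately in the classes of
    [x] and [z].  The Pythagorean condition survives because
    [eta(t)^2 <= 1 - zeta(t)^2 <= 1 - (inf zeta)^2] for every [t] in a class. *)
Require Import Defs.
From mathcomp Require Import all_boot all_order all_algebra.
From mathcomp Require Import all_classical all_reals.
From mathcomp Require Import lra.

Set Implicit Arguments.
Unset Strict Implicit.
Unset Printing Implicit Defensive.

Import Order.TTheory GRing.Theory Num.Theory.

Local Open Scope classical_set_scope.
Local Open Scope ring_scope.

(** * Infima and suprema of a real function over a set *)

Section ImageBounds.
Variables (R : realType) (T : Type).
Implicit Types (f g : T -> R) (A B C : set T).

Lemma le_inf_image f A m :
  A !=set0 -> (forall t, A t -> m <= f t) -> m <= inf (f @` A).
Proof.
move=> A0 mf; apply: lb_le_inf; first exact: image_nonempty.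
by move=> _ [t At <-]; exact: mf.
Qed.

Lemma sup_image_le f A m :
  A !=set0 -> (forall t, A t -> f t <= m) -> sup (f @` A) <= m.
Proof.
move=> A0 fm; apply: ge_sup; first exact: image_nonempty.
by move=> _ [t At <-]; exact: fm.
Qed.

(** The uniform bound [m] makes the image bounded below; without such a bound [inf] is a default
    value and says nothing about [f t]. *)
Lemma inf_image_le f A m t :
  (forall s, m <= f s) -> A t -> inf (f @` A) <= f t.
Proof.
move=> mf At; apply: ge_inf; last by exists t.
by exists m => _ [s _ <-].
Qed.

Lemma le_sup_image f A m t :
  (forall s, f s <= m) -> A t -> f t <= sup (f @` A).
Proof.
move=> fm At; apply: ub_le_sup; last by exists t.
by exists m => _ [s _ <-].
Qed.

Lemma inf_image_01 f A : A !=set0 -> (forall t, 0 <= f t <= 1) ->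
  0 <= inf (f @` A) <= 1.
Proof.
move=> A0 f01.
have f0 t : 0 <= f t by case/andP: (f01 t).
rewrite le_inf_image//=; have [t At] := A0.
by apply: le_trans (inf_image_le f0 At) _; case/andP: (f01 t).
Qed.

Lemma sup_image_01 f A : A !=set0 -> (forall t, 0 <= f t <= 1) ->
  0 <= sup (f @` A) <= 1.
Proof.
move=> A0 f01.
have f1 t : f t <= 1 by case/andP: (f01 t).
rewrite sup_image_le// andbT; have [t At] := A0.
by apply: le_trans (le_sup_image f1 At); case/andP: (f01 t).
Qed.

Lemma inf_image_mono f g A m : A !=set0 -> (forall t, m <= f t) ->
  (forall t, f t <= g t) -> inf (f @` A) <= inf (g @` A).
Proof.
move=> A0 mf fg; apply: le_inf_image => // t At.
exact: le_trans (inf_image_le mf At) (fg t).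
Qed.

Lemma sup_image_mono f g A m : A !=set0 -> (forall t, g t <= m) ->
  (forall t, f t <= g t) -> sup (f @` A) <= sup (g @` A).
Proof.
move=> A0 gm fg; apply: sup_image_le => // t At.
exact: le_trans (fg t) (le_sup_image gm At).
Qed.

Lemma pythagorean_inf_sup f g A : A !=set0 ->
  (forall t, 0 <= f t <= 1) -> (forall t, 0 <= g t <= 1) ->
  (forall t, f t ^+ 2 + g t ^+ 2 <= 1) ->
  inf (f @` A) ^+ 2 + sup (g @` A) ^+ 2 <= 1.
Proof.
move=> A0 f01 g01 fg1.
have /andP[i0 i1] := inf_image_01 A0 f01.
have /andP[s0 _] := sup_image_01 A0 g01.
have f0 t : 0 <= f t by case/andP: (f01 t).
have d0 : 0 <= 1 - inf (f @` A) ^+ 2 by rewrite subr_ge0 expr_le1.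
(* The square root turns the bound on squares into an upper bound for the values of [g] on [A], to
   which the supremum property applies; [d0] allows squaring back. *)
suff : sup (g @` A) <= Num.sqrt (1 - inf (f @` A) ^+ 2).
  by rewrite -(ler_pXn2r (n := 2)) ?nnegrE ?sqrtr_ge0// sqr_sqrtr//; lra.
apply: sup_image_le => // t At.
have g0 : 0 <= g t by case/andP: (g01 t).
rewrite -(ler_pXn2r (n := 2)) ?nnegrE ?sqrtr_ge0// sqr_sqrtr//.
have : inf (f @` A) ^+ 2 <= f t ^+ 2.
  by rewrite ler_pXn2r ?nnegrE// (inf_image_le f0).
by have := fg1 t; lra.
Qed.

(** An infimum on the right is tested at every [c] in [C], so [H] must decompose an arbitrary
    element of [C]; the values at [a] and [b] lie above the two infima. *)
Lemma min_inf_image_le f A B C m : C !=set0 -> (forall t, m <= f t) ->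
  (forall c, C c -> exists a b, [/\ A a, B b & Num.min (f a) (f b) <= f c]) ->
  Num.min (inf (f @` A)) (inf (f @` B)) <= inf (f @` C).
Proof.
move=> C0 mf H; apply: le_inf_image => // c /H[a [b [Aa Bb]]].
apply: le_trans; rewrite le_min !ge_min.
by rewrite (inf_image_le mf Aa) (inf_image_le mf Bb) orbT.
Qed.

Lemma sup_image_le_max f A B C m : C !=set0 -> (forall t, f t <= m) ->
  (forall c, C c -> exists a b, [/\ A a, B b & f c <= Num.max (f a) (f b)]) ->
  sup (f @` C) <= Num.max (sup (f @` A)) (sup (f @` B)).
Proof.
move=> C0 fm H; apply: sup_image_le => // c /H[a [b [Aa Bb]]].
move/le_trans; apply; rewrite ge_max !le_max.
by rewrite (le_sup_image fm Aa) (le_sup_image fm Bb) orbT.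
Qed.

(** If both suprema on the left exceeded the one over [C], some [f a] and [f b] would exceed it too,
    and [H] would give a value on [C] above its own supremum. The common threshold replaces any
    epsilon. *)
Lemma min_sup_image_le f A B C m : A !=set0 -> B !=set0 ->
  (forall t, f t <= m) ->
  (forall a b, A a -> B b -> exists2 c, C c & Num.min (f a) (f b) <= f c) ->
  Num.min (sup (f @` A)) (sup (f @` B)) <= sup (f @` C).
Proof.
move=> A0 B0 fm H; rewrite leNgt lt_min; apply/negP => /andP[].
case/(sup_gt (image_nonempty f A0)) => _ [a Aa <-] Ca.
case/(sup_gt (image_nonempty f B0)) => _ [b Bb <-] Cb.
have [c Cc] := H a b Aa Bb.
move/(le_trans)/(_ (le_sup_image fm Cc)).
by rewrite leNgt lt_min Ca Cb.
Qed.

Lemma inf_image_le_max f A B C m : A !=set0 -> B !=set0 ->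
  (forall t, m <= f t) ->
  (forall a b, A a -> B b -> exists2 c, C c & f c <= Num.max (f a) (f b)) ->
  inf (f @` C) <= Num.max (inf (f @` A)) (inf (f @` B)).
Proof.
move=> A0 B0 mf H; rewrite leNgt gt_max; apply/negP => /andP[].
case/(inf_lt (image_nonempty f A0)) => _ [a Aa <-] Ca.
case/(inf_lt (image_nonempty f B0)) => _ [b Bb <-] Cb.
have [c Cc] := H a b Aa Bb.
move/(le_trans (inf_image_le mf Cc)).
by rewrite leNgt gt_max Ca Cb.
Qed.

End ImageBounds.

(** * Products of classes under a complete congruence *)

Section CompleteCongruence.
Variables (S : semigroupType) (omega : S -> S -> Prop).
Hypothesis omegaC : complete_congruence omega.

Lemma cls_refl z : cls omega z z.
Proof. by case: omegaC => -[[refl _ _] _] _; exact: refl. Qed.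

Lemma cls_nonempty z : cls omega z !=set0.
Proof. by exists z; exact: cls_refl. Qed.

Lemma mem_cls_mul a b x z : cls omega x a -> cls omega z b ->
  cls omega (x * z)%g (a * b)%g.
Proof. by case: omegaC => _ <- xa zb; exists a => //; exists b. Qed.

(** The inclusion of [xz] in [x][z], which is what completeness adds to a congruence. *)
Lemma cls_mulP x z c : cls omega (x * z)%g c ->
  exists a b, [/\ cls omega x a, cls omega z b & c = (a * b)%g].
Proof. by case: omegaC => _ <- [a xa [b zb <-]]; exists a, b. Qed.

Lemma mem_cls_sandwich a b x y z : cls omega x a -> cls omega z b ->
  cls omega (x * y * z)%g (a * y * b)%g.
Proof.
by move=> xa zb; apply: mem_cls_mul zb; apply: mem_cls_mul xa (cls_refl y).
Qed.

(** The class of the middle factor [t] is forgotten, since the bi-ideal inequalities hold for every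
    middle factor. *)
Lemma cls_sandwichP x y z c : cls omega (x * y * z)%g c ->
  exists a t b, [/\ cls omega x a, cls omega z b & c = (a * t * b)%g].
Proof.
case/cls_mulP => d [b [/cls_mulP[a [t [xa _ ->]]] zb ->]].
by exists a, t, b.
Qed.

Section LowerComponents.
Variables (R : realType) (f : S -> R).
Hypothesis f01 : forall t, 0 <= f t <= 1.

Let f0 t : 0 <= f t. Proof. by case/andP: (f01 t). Qed.
Let f1 t : f t <= 1. Proof. by case/andP: (f01 t). Qed.

(** Meant for both endpoints of [zeta_itv]; the three lemmas after it serve [eta_itv], [zeta] and
    [eta] in turn. This one and [sup_cls_max] factor elements of the class of the product, the other
    two build such elements. *)
Lemma inf_cls_min x y z :
  (forall a t b, Num.min (f a) (f b) <= f (a * t * b)%g) ->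
  Num.min (inf (f @` cls omega x)) (inf (f @` cls omega z)) <=
  inf (f @` cls omega (x * y * z)%g).
Proof.
move=> H; apply: min_inf_image_le f0 _ => [|c]; first exact: cls_nonempty.
by case/cls_sandwichP => a [t [b [xa zb ->]]]; exists a, b.
Qed.

Lemma sup_cls_min x y z :
  (forall a t b, Num.min (f a) (f b) <= f (a * t * b)%g) ->
  Num.min (sup (f @` cls omega x)) (sup (f @` cls omega z)) <=
  sup (f @` cls omega (x * y * z)%g).
Proof.
move=> H; apply: min_sup_image_le f1 _ => [||a b xa zb];
  do ?exact: cls_nonempty.
by exists (a * y * b)%g => //; exact: mem_cls_sandwich.
Qed.

Lemma inf_cls_max x y z :
  (forall a t b, f (a * t * b)%g <= Num.max (f a) (f b)) ->
  inf (f @` cls omega (x * y * z)%g) <=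
  Num.max (inf (f @` cls omega x)) (inf (f @` cls omega z)).
Proof.
move=> H; apply: inf_image_le_max f0 _ => [||a b xa zb];
  do ?exact: cls_nonempty.
by exists (a * y * b)%g => //; exact: mem_cls_sandwich.
Qed.

Lemma sup_cls_max x y z :
  (forall a t b, f (a * t * b)%g <= Num.max (f a) (f b)) ->
  sup (f @` cls omega (x * y * z)%g) <=
  Num.max (sup (f @` cls omega x)) (sup (f @` cls omega z)).
Proof.
move=> H; apply: sup_image_le_max f1 _ => [|c]; first exact: cls_nonempty.
by case/cls_sandwichP => a [t [b [xa zb ->]]]; exists a, b.
Qed.

End LowerComponents.
End CompleteCongruence.

(** * Interval infima and suprema, endpoint by endpoint *)

Lemma inf_itv_image (R : realType) (T : Type) (f : T -> itvpair R)
    (A : set T) :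
  Defs.inf_itv (f @` A) =
  (inf ((fun t => (f t).1) @` A), inf ((fun t => (f t).2) @` A)).
Proof. by rewrite /Defs.inf_itv !image_comp. Qed.

Lemma sup_itv_image (R : realType) (T : Type) (f : T -> itvpair R)
    (A : set T) :
  Defs.sup_itv (f @` A) =
  (sup ((fun t => (f t).1) @` A), sup ((fun t => (f t).2) @` A)).
Proof. by rewrite /Defs.sup_itv !image_comp. Qed.

Lemma subitv01_bounds (R : realType) (a : itvpair R) : subitv01 a ->
  [/\ 0 <= a.1 <= 1, 0 <= a.2 <= 1 & a.1 <= a.2].
Proof.
case=> a0 a12 a1; split=> //.
  by rewrite a0 (le_trans a12).
by rewrite a1 (le_trans a0).
Qed.

Lemma inf_itv_subitv01 (R : realType) (T : Type) (f : T -> itvpair R)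
    (A : set T) : A !=set0 ->
  (forall t, subitv01 (f t)) -> subitv01 (Defs.inf_itv (f @` A)).
Proof.
move=> A0 f01; rewrite inf_itv_image.
have f101 t : 0 <= (f t).1 <= 1 by case: (subitv01_bounds (f01 t)).
have f201 t : 0 <= (f t).2 <= 1 by case: (subitv01_bounds (f01 t)).
split=> /=.
- by case/andP: (inf_image_01 A0 f101).
(* Passing to infima preserves the order of the endpoints; [0] bounds the left endpoints from
   below. *)
- apply: (@inf_image_mono _ _ _ _ _ 0) => // t; first by case/andP: (f101 t).
  by case: (f01 t).
- by case/andP: (inf_image_01 A0 f201).
Qed.

Lemma sup_itv_subitv01 (R : realType) (T : Type) (f : T -> itvpair R)
    (A : set T) : A !=set0 ->
  (forall t, subitv01 (f t)) -> subitv01 (Defs.sup_itv (f @` A)).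
Proof.
move=> A0 f01; rewrite sup_itv_image.
have f101 t : 0 <= (f t).1 <= 1 by case: (subitv01_bounds (f01 t)).
have f201 t : 0 <= (f t).2 <= 1 by case: (subitv01_bounds (f01 t)).
split=> /=.
- by case/andP: (sup_image_01 A0 f101).
(* Here [1] bounds the right endpoints from above. *)
- apply: (@sup_image_mono _ _ _ _ _ 1) => // t; first by case/andP: (f201 t).
  by case: (f01 t).
- by case/andP: (sup_image_01 A0 f201).
Qed.

Theorem theorem4p6 (R : realType) (S : semigroupType)
    (omega : S -> S -> Prop) (P : cubic_data R S) :
  complete_congruence omega ->
  cpf_biideal P ->
  cpf_biideal (lower_App omega P).
Proof.
move=> omegaC [cpfsP idealP].
have zi t : subitv01 (zeta_itv P t) by case: (cpfsP t) => -[].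
have ei t : subitv01 (eta_itv P t) by case: (cpfsP t) => -[].
have z01 t : 0 <= zeta P t <= 1 by case: (cpfsP t) => _ [].
have e01 t : 0 <= eta P t <= 1 by case: (cpfsP t) => _ [].
have zi1 t : 0 <= (zeta_itv P t).1 <= 1 by case: (subitv01_bounds (zi t)).
have zi2 t : 0 <= (zeta_itv P t).2 <= 1 by case: (subitv01_bounds (zi t)).
have ei1 t : 0 <= (eta_itv P t).1 <= 1 by case: (subitv01_bounds (ei t)).
have ei2 t : 0 <= (eta_itv P t).2 <= 1 by case: (subitv01_bounds (ei t)).
split=> [z|x y z].
  have cls0 := cls_nonempty omegaC z; split; split=> /=.
  - exact: inf_itv_subitv01.
  - exact: sup_itv_subitv01.
  (* The condition involves right endpoints alone: the infimum of those of [zeta_itv] and the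
     supremum of those of [eta_itv]. *)
  - rewrite !image_comp.
    by apply: pythagorean_inf_sup => // t; case: (cpfsP t) => -[].
  - exact: inf_image_01.
  - exact: sup_image_01.
  - by apply: pythagorean_inf_sup => // t; case: (cpfsP t) => _ [].
split=> /=.
(* [min_itv] and [le_itv] act componentwise, so each endpoint is a separate instance of the real
   inequality. *)
- rewrite !inf_itv_image; split=> /=; apply: inf_cls_min => // a t b;
    by case: (idealP a t b) => -[].
- rewrite !sup_itv_image; split=> /=; apply: sup_cls_min => // a t b;
    by case: (idealP a t b) => _ [].
- by apply: inf_cls_max => // a t b; case: (idealP a t b).
- by apply: sup_cls_max => // a t b; case: (idealP a t b).
Qed.
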